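(* Let $\mathcal{S}$ and $\mathcal{S}_n$, $n\in\mathbb{N}$, be non-commutative graphs (operator systems) in $M_d$ such that $\mathcal{S}=\lim_{n\to\infty}\mathcal{S}_n$. Then $\mathrm{th}(\mathcal{S})=\lim_{n\to\infty}\mathrm{th}(\mathcal{S}_n)$ and $\theta(\mathcal{S}_n)\to_{n\to\infty}\theta(\mathcal{S})$.
   Context: An operator system, or non-commutative graph, in $M_d$ (complex $d\times d$ matrices) is a linear subspace $\mathcal{S}$ containing $I$ and closed under adjoints. Convergence of sets is in the sense of Kuratowski, with subsets of the topological space $M_d$: for a sequence $(F_n)_{n\in\mathbb{N}}$ of subsets, $\liminf_n F_n$ is the set of limits $\lim_n x_n$ of convergent sequences with $x_n\in F_n$ for all $n$; $\limsup_n F_n$ is the set of all cluster points of sequences $(x_n)$ with $x_n\in F_n$ for all $n$; and $F=\lim_{n\to\infty}F_n$ means $F=\liminf_nF_n=\limsup_nF_n$. A quantum channel is a completely positive trace preserving linear map. If $\Phi:M_d\to M_k$ is completely positive with Kraus representation $\Phi(T)=\sum_{p=1}^mA_pTA_p^*$, put $\mathcal{S}_\Phi=\mathrm{span}\{A_p^*A_q : p,q=1,\dots,m\}$ (independent of the Kraus representation). Let $\mathfrak{C}(\mathcal{S})$ be the set of all quantum channels $\Phi:M_d\to M_k$, $k\in\mathbb{N}$ arbitrary, with $\mathcal{S}_\Phi\subseteq\mathcal{S}$. Define $\mathrm{th}(\mathcal{S})=\{T\in M_d^+ : \Phi(T)\le I\text{ for every }\Phi\in\mathfrak{C}(\mathcal{S})\}$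 and $\theta(\mathcal{S})=\sup\{\mathrm{Tr}(T) : T\in\mathrm{th}(\mathcal{S})\}$. *)

(* Defs.v *)
From mathcomp Require Import all_boot all_order all_algebra.
From mathcomp Require Import spectral sesquilinear complex.
From mathcomp Require Import all_classical all_reals all_analysis.

Set Implicit Arguments.
Unset Strict Implicit.
Unset Printing Implicit Defensive.

Import Order.TTheory GRing.Theory Num.Theory numFieldNormedType.Exports.

Local Open Scope classical_set_scope.
Local Open Scope sesquilinear_scope.
Local Open Scope ring_scope.

(* The complex numbers, typed as a numClosedFieldType so that [Cx R] and
   matrices over it carry the topology of the norm, which MathComp-Analysis
   does not attach to the bare type [R[i]]. *)
Definition Cx (R : realType) : numClosedFieldType := R[i].

Section Kuratowski.
Context {T : topologicalType}.

Definition kuratowski_liminf (F : nat -> set T) : set T :=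
  [set x | exists u : nat -> T, (forall n, F n (u n)) /\ u @ \oo --> x].

Definition kuratowski_limsup (F : nat -> set T) : set T :=
  [set x | exists u : nat -> T, (forall n, F n (u n)) /\ cluster (u @ \oo) x].

Definition kuratowski_cvg (F : nat -> set T) (L : set T) : Prop :=
  L = kuratowski_liminf F /\ L = kuratowski_limsup F.

End Kuratowski.

Section Channels.
Context {R : realType}.
Local Notation C := (Cx R).

(* The order of [C] is the partial one: [0 <= z] says that [z] is real and
   nonnegative. *)
Definition psdmx n (A : 'M[C]_n) : Prop :=
  A \is hermsymmx /\ forall v : 'cV[C]_n, 0 <= (v^t* *m A *m v) 0 0.

Definition lemx n (A B : 'M[C]_n) : Prop := psdmx (B - A).

Definition operator_system d (S : {vspace 'M[C]_d}) : Prop :=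
  1%:M \in S /\ forall X, X \in S -> X^t* \in S.

(* A matrix in M_n(M_d) is given by its family of d x d blocks. *)
Definition completely_positive d k (Phi : {linear 'M[C]_d -> 'M[C]_k}) : Prop :=
  forall n (X : 'I_n -> 'I_n -> 'M[C]_d),
    psdmx (\mxblock_(i < n, j < n) X i j) ->
    psdmx (\mxblock_(i < n, j < n) Phi (X i j)).

Definition trace_preserving d k (Phi : {linear 'M[C]_d -> 'M[C]_k}) : Prop :=
  forall T, \tr (Phi T) = \tr T.

Definition quantum_channel d k (Phi : {linear 'M[C]_d -> 'M[C]_k}) : Prop :=
  completely_positive Phi /\ trace_preserving Phi.

Definition kraus_rep d k m (Phi : {linear 'M[C]_d -> 'M[C]_k})
    (A : 'I_m -> 'M[C]_(k, d)) : Prop :=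
  forall T, Phi T = \sum_(p < m) A p *m T *m (A p)^t*.

Definition kraus_span d k m (A : 'I_m -> 'M[C]_(k, d)) : {vspace 'M[C]_d} :=
  <<[seq (A p)^t* *m A q | p <- enum 'I_m, q <- enum 'I_m]>>%VS.

(* The space S_Phi. All Kraus representations of Phi have the same span, so
   the union below is the span attached to any one of them; a completely
   positive Phi has at least one. *)
Definition channel_graph d k (Phi : {linear 'M[C]_d -> 'M[C]_k}) :
    set 'M[C]_d :=
  [set X | exists m (A : 'I_m -> 'M[C]_(k, d)),
             kraus_rep Phi A /\ X \in kraus_span A].

Definition channels d (S : {vspace 'M[C]_d}) k :
    set {linear 'M[C]_d -> 'M[C]_k} :=
  [set Phi | quantum_channel Phi /\ channel_graph Phi `<=` [set` S]].

Definition th d (S : {vspace 'M[C]_d}) : set 'M[C]_d :=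
  [set T | psdmx T /\
           forall k (Phi : {linear 'M[C]_d -> 'M[C]_k}),
             channels S Phi -> lemx (Phi T) 1%:M].

(* For an operator system S the set is nonempty and bounded above (it contains
   [0], and the identity channel forces [T <= I]), so [sup] is a genuine
   supremum; the trace of a positive matrix is real. *)
Definition theta d (S : {vspace 'M[C]_d}) : R :=
  sup [set complex.Re (\tr T) | T in th S].

End Channels.

(* Main.v *)
Require Import Defs.
From mathcomp Require Import all_boot all_order all_algebra.
From mathcomp Require Import spectral sesquilinear complex ring.
From mathcomp Require Import all_classical all_reals all_analysis.
From HB Require Import structures.
Import Order.TTheory GRing.Theory Num.Theory numFieldNormedType.Exports.
Local Open Scope classical_set_scope.
Local Open Scope sesquilinear_scope.
Local Open Scope ring_scope.

(** Membership in [th S] is tested by channels, and a channel enters only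
    through the products [A_p^* A_q] of its Kraus operators.  The key step is
    to turn a channel of [S] into one of a nearby operator system [S'] with
    little loss.

    Suppose a linear map [X |-> X + E X] sends [S] into [S'], where the matrix
    of [E] has small entries.  After symmetrisation the Choi matrix of [E] is
    hermitian with small entries, so adding a small multiple of the identity
    makes it positive: [E X + (c tr X) I] is a sum of terms [K_l X K_l^*].
    Given Kraus operators [A_p] of a channel of [S], stack
    [A_p, A_p K_1^*, A_p K_2^*, ...] into a single column [B_p].  Then
    [B_p^* B_q = X + E X + (c tr X) I] for [X = A_p^* A_q], which lies in [S'];
    the sum of the [B_p^* B_p] exceeds [I] by a small amount only; and the
    upper left corner of [sum_p B_p T B_p^*] is [sum_p A_p T A_p^*].  No bound
    on the number of Kraus operators is involved, so the loss is uniform over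
    all channels: if [T] is in [th S'] then [T / r] is in [th S] for a number
    [r] close to [1] ([th_of_near_graph]).

    For [E] take compressions by the orthogonal projections [P] and [P_n] onto
    [S] and [S_n], in the Euclidean space of matrices: [P (P_n - 1)] leads
    from [S] to [S_n], and [P_n (P - 1)] leads back.  Kuratowski convergence
    of the subspaces forces [P_n --> P] ([projection_cvg]): the entries of the
    [P_n] stay in the unit disc, and any cluster point [Q] is hermitian, fixes
    [S] because [S] is in the lower limit, and has range in [S] because the
    upper limit is in [S]; hence [Q = P].

    So there are [r_n --> 1] such that division by [r_n] carries [th S] into
    [th S_n] and [th S_n] into [th S] ([th_scaling]).  As [th S] is closed,
    both Kuratowski limits of the [th S_n] are [th S]; taking traces gives
    [theta S / r_n <= theta S_n <= r_n theta S], and the squeeze theorem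
    concludes. *)

Set Implicit Arguments.
Unset Strict Implicit.
Unset Printing Implicit Defensive.

(** * Adjoints and positive semidefinite matrices *)

Section Adjoint.
Context {C : numClosedFieldType}.

Lemma adjM m n p (A : 'M[C]_(m, n)) (B : 'M[C]_(n, p)) :
  (A *m B)^t* = B^t* *m A^t*.
Proof. by rewrite trmx_mul map_mxM. Qed.

Lemma adjD m n (A B : 'M[C]_(m, n)) : (A + B)^t* = A^t* + B^t*.
Proof. by rewrite linearD map_mxD. Qed.

Lemma adjZ m n (a : C) (A : 'M[C]_(m, n)) : (a *: A)^t* = a^* *: A^t*.
Proof. by rewrite linearZ map_mxZ. Qed.

Lemma adj_sum m n I (r : seq I) (P : pred I) (F : I -> 'M[C]_(m, n)) :
  (\sum_(i <- r | P i) F i)^t* = \sum_(i <- r | P i) (F i)^t*.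
Proof. by rewrite linear_sum map_mx_sum. Qed.

Lemma adj_scalar n (a : C) : (a%:M : 'M[C]_n)^t* = (a^*)%:M.
Proof. by rewrite tr_scalar_mx map_scalar_mx. Qed.

Lemma adj_mxcol n p (p_ : 'I_p -> nat) (B : forall i, 'M[C]_(p_ i, n)) :
  (\mxcol_i B i)^t* = \mxrow_i (B i)^t*.
Proof. by rewrite tr_mxcol; apply/matrixP => i j; rewrite !mxE. Qed.

Lemma adj_mxrow n p (p_ : 'I_p -> nat) (B : forall i, 'M[C]_(n, p_ i)) :
  (\mxrow_i B i)^t* = \mxcol_i (B i)^t*.
Proof. by rewrite tr_mxrow; apply/matrixP => i j; rewrite !mxE. Qed.

Lemma adj_col_mx m1 m2 n (A : 'M[C]_(m1, n)) (B : 'M[C]_(m2, n)) :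
  (col_mx A B)^t* = row_mx (A^t*) (B^t*).
Proof. by rewrite tr_col_mx map_row_mx. Qed.

Lemma gram_entryE m n (A : 'M[C]_(m, n)) i : (A^t* *m A) i i = \sum_j `|A j i| ^+ 2.
Proof. by rewrite !mxE; apply: eq_bigr => j _; rewrite !mxE normCKC. Qed.

Lemma gram_entry_ge0 m n (A : 'M[C]_(m, n)) i : 0 <= (A^t* *m A) i i.
Proof. by rewrite gram_entryE sumr_ge0 // => j _; rewrite exprn_ge0. Qed.

Lemma gram_eq0 m n (A : 'M[C]_(m, n)) : A^t* *m A = 0 -> A = 0.
Proof.
move=> A0; apply/matrixP => i j; rewrite [RHS]mxE; apply/eqP.
have: (A^t* *m A) j j == 0 by rewrite A0 mxE.
rewrite gram_entryE psumr_eq0 => [/allP/(_ i)|k _]; last exact: exprn_ge0.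
by rewrite mem_index_enum sqrf_eq0 normr_eq0 => /(_ isT).
Qed.

(** The kernel of [V^* V] is that of [V], so the Gram matrix determines the
    row space. *)
Lemma submx_of_gram m1 m2 n (V : 'M[C]_(m1, n)) (W : 'M[C]_(m2, n)) :
  W^t* *m W = V^t* *m V -> (W <= V)%MS.
Proof.
move=> WV; rewrite submxE; apply/eqP/gram_eq0.
have: V *m cokermx V = 0 by exact: mulmx_coker.
move: (cokermx V) => K VK.
by rewrite adjM -mulmxA (mulmxA _ W) WV -mulmxA VK !mulmx0.
Qed.

Lemma entry_bound_ge0 n (H : 'M[C]_n) (e : C) :
  (forall i j, `|H i j| <= e) -> 0 <= n%:R * e.
Proof.
case: n H => [|n] H He; first by rewrite mul0r.
by apply: mulr_ge0 => //; apply: le_trans (He 0 0).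
Qed.

(** A hermitian matrix of size [n] with entries at most [e] has operator norm
    at most [n e], because [2 |v_i| |v_j| <= |v_i|^2 + |v_j|^2]. *)
Lemma hermitian_quad_ge n (H : 'M[C]_n) (e : C) (v : 'cV[C]_n) :
  H^t* = H -> (forall i j, `|H i j| <= e) ->
  0 <= (v^t* *m H *m v) 0 0 + n%:R * e * (v^t* *m v) 0 0.
Proof.
move=> hH He; pose q : C := (v^t* *m H *m v) 0 0.
have qE : q = \sum_i \sum_j (v i 0)^* * H i j * v j 0.
  rewrite /q mxE exchange_big; apply: eq_bigr => j _; rewrite mxE mulr_suml.
  by apply: eq_bigr => i _; rewrite !mxE.
have q_real : q \is Num.real.
  apply/CrealP; have : (v^t* *m H *m v)^t* 0 0 = q.
    by rewrite !adjM trmxCK hH mulmxA.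
  by rewrite 2!mxE.
rewrite gram_entryE -/q.
suff : `|q| <= n%:R * e * \sum_i `|v i 0| ^+ 2.
  by rewrite real_ler_norml // => /andP[+ _]; rewrite -subr_ge0 opprK.
rewrite qE; apply: le_trans (ler_norm_sum _ _ _) _.
have -> : n%:R * e * \sum_i `|v i 0| ^+ 2 =
    \sum_(i < n) \sum_(j < n) e * ((`|v i 0| ^+ 2 + `|v j 0| ^+ 2) / 2).
  under [RHS]eq_bigr do rewrite -mulr_sumr -mulr_suml big_split /= sumr_const card_ord.
  rewrite -mulr_sumr -mulr_suml big_split /= sumr_const card_ord sumrMnl.
  set s := \sum_i _; rewrite -mulr2n -[s *+ n *+ 2]mulr_natr mulfK ?pnatr_eq0 //.
  by rewrite -mulr_natl; ring.
apply: ler_sum => i _; apply: le_trans (ler_norm_sum _ _ _) _.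
apply: ler_sum => j _; rewrite !normrM norm_conjC mulrAC [X in X <= _]mulrC.
apply: ler_pM => //.
rewrite ler_pdivlMr // -subr_ge0.
have -> : `|v i 0| ^+ 2 + `|v j 0| ^+ 2 - `|v i 0| * `|v j 0| * 2 =
  (`|v i 0| - `|v j 0|) ^+ 2 by ring.
by rewrite real_exprn_even_ge0 // rpredB ?normr_real.
Qed.

End Adjoint.

Section Psd.
Context {R : realType}.
Local Notation C := (Cx R).

Lemma psdmxP n (A : 'M[C]_n) :
  psdmx A <-> A^t* = A /\ forall v : 'cV[C]_n, 0 <= (v^t* *m A *m v) 0 0.
Proof.
split=> -[hA pA]; split=> //.
  by move/is_hermitianmxP: hA; rewrite expr0 scale1r.
by apply/is_hermitianmxP; rewrite expr0 scale1r hA.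
Qed.

Lemma psd_adj n (A : 'M[C]_n) : psdmx A -> A^t* = A.
Proof. by case/psdmxP. Qed.

Lemma psd_conj m n (B : 'M[C]_(m, n)) (A : 'M[C]_m) :
  psdmx A -> psdmx (B^t* *m A *m B).
Proof.
case/psdmxP => hA pA; apply/psdmxP; split; first by rewrite !adjM trmxCK hA mulmxA.
by move=> v; have := pA (B *m v); rewrite adjM !mulmxA.
Qed.

Lemma psd1 n : psdmx (1%:M : 'M[C]_n).
Proof.
apply/psdmxP; split; first by rewrite adj_scalar conjC1.
by move=> v; rewrite mulmx1 gram_entry_ge0.
Qed.

Lemma psd_gram m n (B : 'M[C]_(m, n)) : psdmx (B^t* *m B).
Proof. by have := psd_conj B (psd1 m); rewrite mulmx1. Qed.

Lemma psd0 n : psdmx (0 : 'M[C]_n).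
Proof. by rewrite -(mulmx0 _ (0^t* : 'M[C]_(n, n))); exact: psd_gram. Qed.

Lemma psdD n (A B : 'M[C]_n) : psdmx A -> psdmx B -> psdmx (A + B).
Proof.
case/psdmxP => hA pA /psdmxP[hB pB]; apply/psdmxP; split; first by rewrite adjD hA hB.
by move=> v; rewrite mulmxDr mulmxDl mxE; apply: addr_ge0; [exact: pA | exact: pB].
Qed.

Lemma psd_sum n I (r : seq I) (P : pred I) (F : I -> 'M[C]_n) :
  (forall i, P i -> psdmx (F i)) -> psdmx (\sum_(i <- r | P i) F i).
Proof. by move=> h; apply: big_ind; [exact: psd0 | exact: psdD | exact: h]. Qed.

Lemma psdZ n (a : C) (A : 'M[C]_n) : 0 <= a -> psdmx A -> psdmx (a *: A).
Proof.
move=> a0 /psdmxP[hA pA]; apply/psdmxP; split=> [|v].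
  by rewrite adjZ hA geC0_conj.
by rewrite -scalemxAr -scalemxAl mxE mulr_ge0.
Qed.

(** By the spectral theorem [A = P^* D P] with [P] unitary and [D] diagonal;
    take [G] to be the square root of [D] times [P]. *)
Lemma psd_factor n (A : 'M[C]_n) : psdmx A -> exists G : 'M[C]_n, A = G^t* *m G.
Proof.
case=> hA pA; have /orthomx_spectralP := hermitian_normalmx hA.
have := spectral_unitarymx A; move: (spectralmx A) (spectral_diag A) => P D uP.
rewrite (invmx_unitary uP) => eA.
have D0 j : 0 <= D 0 j.
  have PA : P *m A *m P^t* = diag_mx D.
    by rewrite eA !mulmxA (unitarymxP uP) mul1mx -mulmxA (unitarymxP uP) mulmx1.
  have := pA (P^t* *m delta_mx j 0).
  rewrite adjM trmxCK -!mulmxA (mulmxA A) (mulmxA P) (mulmxA P) PA.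
  by rewrite -colE trmx_delta map_delta_mx -rowE !mxE eqxx mulr1n.
exists (diag_mx (map_mx sqrtC D) *m P).
rewrite adjM -!mulmxA [X in _ *m X]mulmxA tr_diag_mx map_diag_mx mulmx_diag.
rewrite [X in diag_mx X](_ : _ = D); first by rewrite mulmxA.
apply/rowP => j; rewrite !mxE.
suff : (sqrtC (D 0 j))^* * sqrtC (D 0 j) = D 0 j by [].
by rewrite geC0_conj ?sqrtC_ge0 // -expr2 sqrtCK.
Qed.

Lemma herm_psd n (H : 'M[C]_n) (e : C) :
  H^t* = H -> (forall i j, `|H i j| <= e) -> psdmx (H + (n%:R * e)%:M).
Proof.
move=> hH He; have ne := entry_bound_ge0 He.
apply/psdmxP; split; first by rewrite adjD hH adj_scalar geC0_conj.
move=> v; rewrite mulmxDr mulmxDl mul_mx_scalar -scalemxAl mxE [X in _ + X]mxE.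
exact: hermitian_quad_ge.
Qed.

End Psd.

(** * Kraus representations *)

Section Kraus.
Context {R : realType}.
Local Notation C := (Cx R).

(** The existence half of Choi's theorem.  Write the block matrix as [G^* G]:
    the [l]-th rows of the block columns of [G], conjugated, are the columns
    of the [l]-th Kraus operator. *)
Lemma choi_kraus d k (B : 'I_d -> 'I_d -> 'M[C]_k) :
  psdmx (\mxblock_(i, j) B i j) ->
  exists m (A : 'I_m -> 'M[C]_(k, d)), forall X : 'M[C]_d,
    \sum_i \sum_j X i j *: B i j = \sum_(p < m) A p *m X *m (A p)^t*.
Proof.
move=> /psd_factor[G eG].
have eB i j : B i j = (submxrow G i)^t* *m submxrow G j.
  move: i j; apply/(@eq_mxblockP C d d (fun _ => k) (fun _ => k)).
  by rewrite eG -{1 2}(submxrowK G) adj_mxrow mul_mxcol_mxrow.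
exists _, (fun l => \matrix_(i, a) (submxrow G a l i)^*) => X.
apply/matrixP => i j; rewrite !summxE.
transitivity (\sum_a \sum_b \sum_l
   (submxrow G a l i)^* * X a b * submxrow G b l j).
  apply: eq_bigr => a _; rewrite summxE; apply: eq_bigr => b _.
  rewrite !mxE eB !mxE mulr_sumr; apply: eq_bigr => l _.
  by rewrite !mxE mulrCA mulrA.
transitivity (\sum_l \sum_b \sum_a
   (submxrow G a l i)^* * X a b * submxrow G b l j).
  rewrite exchange_big [RHS]exchange_big; apply: eq_bigr => b _.
  by rewrite exchange_big.
apply: eq_bigr => l _; rewrite !mxE; apply: eq_bigr => b _.
rewrite !mxE mulr_suml; apply: eq_bigr => a _.
by rewrite !mxE conjCK.
Qed.

Lemma linear_delta d k (Phi : {linear 'M[C]_d -> 'M[C]_k}) X :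
  Phi X = \sum_i \sum_j X i j *: Phi (delta_mx i j).
Proof.
rewrite {1}(matrix_sum_delta X) linear_sum; apply: eq_bigr => i _.
by rewrite linear_sum; apply: eq_bigr => j _; rewrite linearZ.
Qed.

Lemma cp_kraus d k (Phi : {linear 'M[C]_d -> 'M[C]_k}) :
  completely_positive Phi ->
  exists m (A : 'I_m -> 'M[C]_(k, d)), kraus_rep Phi A.
Proof.
move=> /(_ d (fun i j => delta_mx i j)) cpPhi.
have /cpPhi /choi_kraus[m [A hA]] :
    psdmx (\mxblock_(i < d, j < d) (delta_mx i j : 'M[C]_d)).
  pose V : 'M[C]_(1, \sum_(i < d) d) := \mxrow_(i < d) delta_mx 0 i.
  have -> : \mxblock_(i < d, j < d) (delta_mx i j : 'M[C]_d) = V^t* *m V.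
    rewrite adj_mxrow mul_mxcol_mxrow; apply/eq_mxblock => i j.
    by rewrite trmx_delta map_delta_mx mul_delta_mx.
  exact: psd_gram.
by exists m, A => T; rewrite linear_delta hA.
Qed.

Lemma mul_delta_mxE k d e l (X : 'M[C]_(k, d)) a b (Y : 'M[C]_(e, l)) i j :
  (X *m delta_mx a b *m Y) i j = X i a * Y b j.
Proof.
rewrite -(mul_delta_mx (0 : 'I_1)) mulmxA -mulmxA -colE -rowE mxE big_ord1.
by rewrite !mxE.
Qed.

(** Two Kraus families of one map have the same Choi matrix, which is the Gram
    matrix of the vectorised operators; it determines their span. *)
Lemma kraus_unique d k (Phi : {linear 'M[C]_d -> 'M[C]_k}) m n
    (A : 'I_m -> 'M[C]_(k, d)) (B : 'I_n -> 'M[C]_(k, d)) :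
  kraus_rep Phi A -> kraus_rep Phi B ->
  forall p, exists u : 'I_m -> C, B p = \sum_q u q *: A q.
Proof.
move=> hA hB p.
pose W r (Z : 'I_r -> 'M[C]_(k, d)) :=
  \matrix_(i < r, s < k * d) (mxvec (Z i) 0 s)^*.
have WE r (Z : 'I_r -> 'M[C]_(k, d)) : kraus_rep Phi Z -> forall i a j b,
    ((W r Z)^t* *m W r Z) (mxvec_index i a) (mxvec_index j b) =
    Phi (delta_mx a b) i j.
  move=> hZ i a j b; rewrite hZ mxE summxE; apply: eq_bigr => q _.
  by rewrite mul_delta_mxE !mxE !mxvecE conjCK.
have /row_subP/(_ p)/submxP[u uE] : (W n B <= W m A)%MS.
  apply: submx_of_gram; apply/matrixP; do 2![case/mxvec_indexP => ? ?].
  by rewrite !WE.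
exists (fun q => (u 0 q)^*); apply/matrixP => i a.
have /rowP/(_ (mxvec_index i a)) := uE; rewrite !mxE mxvecE.
move/(congr1 Num.conj); rewrite conjCK => ->.
rewrite summxE rmorph_sum; apply: eq_bigr => q _.
by rewrite !mxE rmorphM /= conjCK mxvecE.
Qed.

(** The graph of a map is a union over all its Kraus families; by uniqueness
    of the span it is enough to control one of them. *)
Lemma kraus_graph d k (Phi : {linear 'M[C]_d -> 'M[C]_k}) m
    (A : 'I_m -> 'M[C]_(k, d)) (S : {vspace 'M[C]_d}) :
  kraus_rep Phi A -> (forall p q, (A p)^t* *m A q \in S) ->
  channel_graph Phi `<=` [set` S].
Proof.
move=> hA AS X [n [B [hB]]]; apply/subvP/span_subvP => _ /allpairsP[[p q] [_ _ ->]] /=.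
have [u ->] := kraus_unique hA hB p; have [v ->] := kraus_unique hA hB q.
rewrite adj_sum mulmx_suml; apply: memv_suml => i _.
rewrite mulmx_sumr; apply: memv_suml => j _.
by rewrite adjZ -scalemxAl -scalemxAr !memvZ.
Qed.

Lemma graph_kraus d k (Phi : {linear 'M[C]_d -> 'M[C]_k}) m
    (A : 'I_m -> 'M[C]_(k, d)) (S : {vspace 'M[C]_d}) :
  kraus_rep Phi A -> channel_graph Phi `<=` [set` S] ->
  forall p q, (A p)^t* *m A q \in S.
Proof.
move=> hA sub p q; apply: (sub _); exists m, A; split=> //.
by apply: memv_span; apply/allpairsP; exists (p, q); rewrite !mem_enum.
Qed.

(** Each term [A X A^*] acts on block matrices as conjugation by a block
    diagonal matrix.  The latter is rectangular, so it is written as a block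
    matrix with zero blocks off the diagonal. *)
Lemma kraus_cp d k (Phi : {linear 'M[C]_d -> 'M[C]_k}) m
    (A : 'I_m -> 'M[C]_(k, d)) : kraus_rep Phi A -> completely_positive Phi.
Proof.
move=> hA n X psdX.
pose D p : 'M[C]_(\sum_(i < n) k, \sum_(i < n) d) :=
  \mxblock_(i < n, j < n) (if i == j then A p else 0).
have -> : \mxblock_(i, j) Phi (X i j) =
    \sum_p ((D p)^t*)^t* *m \mxblock_(i, j) X i j *m (D p)^t*.
  transitivity (\sum_p \mxblock_(i < n, j < n) (A p *m X i j *m (A p)^t*)).
    by rewrite -mxblock_sum; apply: eq_mxblock => i j; rewrite hA.
  apply: eq_bigr => p _.
  have -> : (D p)^t* = \mxblock_(i < n, j < n) (if i == j then (A p)^t* else 0).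
    rewrite tr_mxblock; apply/matrixP => i j; rewrite !mxE.
    by rewrite eq_sym; case: eqP => _; rewrite ?mxE // conjC0.
  have -> : (\mxblock_(i < n, j < n) (if i == j then (A p)^t* else 0))^t* = D p.
    rewrite tr_mxblock; apply/matrixP => i j; rewrite !mxE.
    by rewrite eq_sym; case: eqP => _; rewrite ?mxE ?conjCK // conjC0.
  rewrite !mul_mxblock; apply: eq_mxblock => i j.
  rewrite (bigD1 j) //= eqxx [X in _ + X]big1 ?addr0 => [|l /negPf ->]; last first.
    by rewrite mulmx0.
  congr (_ *m _); rewrite (bigD1 i) //= eqxx [X in _ + X]big1 ?addr0 // => l.
  by rewrite eq_sym => /negPf ->; rewrite mul0mx.
by apply: psd_sum => p _; exact: psd_conj.
Qed.

Definition kraus_map d k m (A : 'I_m -> 'M[C]_(k, d)) (T : 'M[C]_d) : 'M[C]_k :=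
  \sum_p A p *m T *m (A p)^t*.

Fact kraus_map_linear d k m (A : 'I_m -> 'M[C]_(k, d)) : linear (kraus_map A).
Proof.
move=> a X Y; rewrite /kraus_map scaler_sumr -big_split; apply: eq_bigr => p _ /=.
by rewrite mulmxDr mulmxDl -scalemxAr -scalemxAl.
Qed.

HB.instance Definition _ d k m (A : 'I_m -> 'M[C]_(k, d)) :=
  GRing.isLinear.Build C 'M[C]_d 'M[C]_k *:%R (kraus_map A)
    (kraus_map_linear A).

Lemma kraus_channel d k m (A : 'I_m -> 'M[C]_(k, d)) (S : {vspace 'M[C]_d}) :
  (forall p q, (A p)^t* *m A q \in S) -> \sum_p (A p)^t* *m A p = 1%:M ->
  channels S (kraus_map A).
Proof.
move=> AS A1; have hA : kraus_rep (kraus_map A) A by move=> T.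
split; last exact: kraus_graph hA AS.
split; first exact: kraus_cp hA.
move=> T; rewrite /kraus_map raddf_sum /=.
under eq_bigr do rewrite mxtrace_mulC mulmxA.
by rewrite -raddf_sum -mulmx_suml A1 mul1mx.
Qed.

End Kraus.

(** * Subunital Kraus families *)

Section Subunital.
Context {R : realType}.
Local Notation C := (Cx R).

(** Trace preservation says that [sum_p A_p^* A_p] pairs with every matrix as
    the identity does. *)
Lemma trace_preserving_kraus d k (Phi : {linear 'M[C]_d -> 'M[C]_k}) m
    (A : 'I_m -> 'M[C]_(k, d)) : kraus_rep Phi A -> trace_preserving Phi ->
  \sum_p (A p)^t* *m A p = 1%:M.
Proof.
move=> hA tp; apply/matrixP => j i.
have trE (Q : 'M[C]_d) : \tr (Q *m delta_mx i j) = Q j i.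
  rewrite -(mul_delta_mx (0 : 'I_1)) mulmxA mxtrace_mulC -colE -rowE.
  by rewrite trace_mx11 !mxE.
rewrite -!trE mul1mx -[in RHS]tp hA mulmx_suml !raddf_sum; apply: eq_bigr => p _ /=.
by rewrite [RHS]mxtrace_mulC mulmxA.
Qed.

(** Compression to the first [k] coordinates preserves the operator order; it
    recovers the original channel from an enlarged one. *)
Lemma psd_ul_block k l (c : C) m (B : 'I_m -> 'M[C]_(k, k)) (D : 'I_m -> 'M[C]_(k + l)) :
  (forall p, row_mx 1%:M 0 *m D p *m (row_mx 1%:M 0)^t* = B p) ->
  psdmx (c%:M - \sum_p D p) -> psdmx (c%:M - \sum_p B p).
Proof.
move=> DB; pose E : 'M[C]_(k, k + l) := row_mx 1%:M 0.
have EE : E *m E^t* = 1%:M.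
  by rewrite tr_row_mx map_col_mx mul_row_col mul0mx addr0 mul1mx adj_scalar conjC1.
move=> /(psd_conj (E^t*)); rewrite trmxCK mulmxBr mulmxBl mul_mx_scalar -scalemxAl EE.
rewrite scalemx1 mulmx_sumr mulmx_suml.
by rewrite (eq_bigr _ (fun p _ => DB p)).
Qed.

(** The defining inequality of [th S] extends from channels to Kraus families
    with [sum_p A_p^* A_p <= c].  The defect [c - sum_p A_p^* A_p] is in [S]
    and factors as [G^* G]; taking [G] as one further Kraus operator with
    values in a fresh orthogonal summand makes all its cross products with
    the [A_p] vanish, and division by [c] gives a channel. *)
Lemma th_subunital d (S : {vspace 'M[C]_d}) (T : 'M[C]_d) k m
    (A : 'I_m -> 'M[C]_(k, d)) (c : C) :
  1%:M \in S -> th S T -> 0 < c -> (forall p q, (A p)^t* *m A q \in S) ->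
  psdmx (c%:M - \sum_p (A p)^t* *m A p) ->
  psdmx (c%:M - \sum_p A p *m T *m (A p)^t*).
Proof.
move=> S1 [psdT thT] c0 AS psdA.
have [G eG] := psd_factor psdA.
have GS : G^t* *m G \in S.
  by rewrite -eG -scalemx1 memvB ?memvZ // memv_suml.
pose s := sqrtC c^-1; have ss : s^* * s = c^-1.
  by rewrite geC0_conj ?sqrtC_ge0 ?invr_ge0 ?ltW // -expr2 sqrtCK.
(* Index [0] carries the defect [G]; the index lifted from [p] carries [A p]. *)
pose A' i := oapp A 0 (unlift (0 : 'I_m.+1) i).
pose G' i := if unlift (0 : 'I_m.+1) i is Some _ then 0 else G.
pose B i := s *: col_mx (A' i) (G' i).
have BB i j : (B i)^t* *m B j = c^-1 *: ((A' i)^t* *m A' j + (G' i)^t* *m G' j).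
  by rewrite /B adjZ -scalemxAl -scalemxAr scalerA ss adj_col_mx mul_row_col.
have BS i j : (B i)^t* *m B j \in S.
  rewrite BB memvZ // /A' /G'.
  by case: unliftP => [p _|_]; case: unliftP => [q _|_];
    rewrite /= ?mulmx0 ?trmx0 ?map_mx0 ?mul0mx ?addr0 ?add0r ?mem0v.
have B1 : \sum_i (B i)^t* *m B i = 1%:M.
  rewrite (eq_bigr _ (fun i _ => BB i i)) -scaler_sumr big_ord_recl /A' /G' /=.
  rewrite unlift_none /= mulmx0 add0r -eG.
  under eq_bigr do rewrite liftK /= mulmx0 addr0.
  by rewrite subrK scale_scalar_mx mulVf ?gt_eqF.
have := thT _ _ (kraus_channel BS B1); rewrite /lemx /kraus_map.
move=> /(psd_ul_block (B := fun i => c^-1 *: (A' i *m T *m (A' i)^t*))) psdB.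
have -> : c%:M - \sum_p A p *m T *m (A p)^t* =
    c *: (1%:M - \sum_i c^-1 *: (A' i *m T *m (A' i)^t*)).
  rewrite scalerBr scalemx1 -scaler_sumr scalerA mulfV ?gt_eqF // scale1r.
  rewrite big_ord_recl /A' unlift_none /= !mul0mx add0r.
  by congr (_ - _); apply: eq_bigr => p _; rewrite liftK.
apply: psdZ (ltW c0) _; apply: psdB => i.
have EB : row_mx 1%:M 0 *m B i = s *: A' i.
  by rewrite /B -scalemxAr mul_row_col mul0mx mul1mx addr0.
rewrite !mulmxA EB -mulmxA -adjM EB adjZ -!scalemxAl -scalemxAr scalerA.
by rewrite [s * _]mulrC ss.
Qed.

End Subunital.

(** * Transporting channels to a nearby operator system *)

Section NearGraph.
Context {R : realType}.
Local Notation C := (Cx R).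

(** The blocks [N a b] are the values on matrix units of a hermiticity
    preserving linear map with small entries.  Shifting its Choi matrix by the
    norm bound [c = d^2 e] makes it positive; on the map this adds
    [(c tr X) I].  At the identity matrix the first part contributes at most
    [d (d e)] and the shift exactly [d c], whence the constant [d^3 + d^2]. *)
Lemma hermitian_choi_shift d (N : 'I_d -> 'I_d -> 'M[C]_d) (e : C) :
  0 <= e -> (forall a b, (N a b)^t* = N b a) -> (forall a b i j, `|N a b i j| <= e) ->
  exists m (K : 'I_m -> 'M[C]_d) (c : C),
  [/\ forall X : 'M[C]_d, \sum_l K l *m X *m (K l)^t* =
        \sum_a \sum_b X a b *: N a b + (c * \tr X)%:M,
      0 <= (d ^ 3 + d ^ 2)%:R * e &
      psdmx (((d ^ 3 + d ^ 2)%:R * e)%:M - \sum_l K l *m (K l)^t*)].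
Proof.
move=> e0 hN Ne; pose D := (\sum_(i < d) d)%N.
have eD : D = (d ^ 2)%N by rewrite /D sum_nat_const card_ord mulnn.
have psdH : psdmx (\mxblock_(a < d, b < d) N a b + (D%:R * e)%:M).
  apply: herm_psd => [|s t]; last by rewrite mxE.
  by rewrite tr_mxblock; apply/matrixP => s t; rewrite !mxE -[in RHS]hN !mxE.
pose c := D%:R * e.
have eH : \mxblock_(a < d, b < d) N a b + c%:M =
    \mxblock_(a < d, b < d) (N a b + (c *+ (a == b))%:M).
  rewrite mxblockD -[in LHS](mxdiagZ (p_ := fun _ : 'I_d => d) c); congr (_ + _).
  apply: eq_mxblock => a b; case: eqVneq => [_|_].
    by rewrite conform_mx_id mulr1n.
  by rewrite mulr0n raddf0.
move: psdH; rewrite -/c eH => /choi_kraus[m [K hK]].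
have KE X : \sum_l K l *m X *m (K l)^t* =
    \sum_a \sum_b X a b *: N a b + (c * \tr X)%:M.
  rewrite -hK mulr_sumr raddf_sum -big_split; apply: eq_bigr => a _ /=.
  under eq_bigr do rewrite scalerDr.
  rewrite big_split /=; congr (_ + _).
  rewrite (bigD1 a) //= eqxx big1 ?addr0 => [|b]; last first.
    by rewrite eq_sym => /negPf ->; rewrite raddf0 scaler0.
  by rewrite scale_scalar_mx mulrC.
exists m, K, c; split; first exact: KE.
  by rewrite mulr_ge0.
have -> : \sum_l K l *m (K l)^t* = \sum_a N a a + (c * d%:R)%:M.
  transitivity (\sum_l K l *m 1%:M *m (K l)^t*).
    by apply: eq_bigr => l _; rewrite mulmx1.
  rewrite KE mxtrace1; congr (_ + _); apply: eq_bigr => a _.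
  rewrite (bigD1 a) //= mxE eqxx scale1r big1 ?addr0 // => b.
  by rewrite mxE eq_sym => /negPf ->; rewrite scale0r.
have -> : ((d ^ 3 + d ^ 2)%:R * e)%:M - (\sum_a N a a + (c * d%:R)%:M) =
    (- \sum_a N a a) + (d%:R * (d%:R * e))%:M.
  rewrite opprD addrCA -raddfB /=; congr (_ + _%:M).
  by rewrite /c eD natrD !natrX; ring.
apply: herm_psd => [|i j].
  rewrite linearN /= map_mxN adj_sum; congr (- _).
  by apply: eq_bigr => a _; rewrite hN.
rewrite mxE normrN summxE; apply: le_trans (ler_norm_sum _ _ _) _.
have -> : d%:R * e = \sum_(a < d) e by rewrite sumr_const card_ord mulr_natl.
by apply: ler_sum => a _; exact: Ne.
Qed.

(** The matrix [M] represents, on vectorised matrices, a linear map [E] for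
    which [X + E X] is in [S'] whenever [X] is in [S]. *)
Lemma th_of_near_graph d (S S' : {vspace 'M[C]_d}) (M : 'M[C]_(d * d)) (e : C) :
  operator_system S -> operator_system S' ->
  (forall X, X \in S -> X + vec_mx (mxvec X *m M) \in S') ->
  0 <= e -> (forall s t, `|M s t| <= e) ->
  forall T, th S' T -> th S ((1 + (d ^ 3 + d ^ 2)%:R * e)^-1 *: T).
Proof.
move=> [S1 Sadj] [S'1 S'adj] MS e0 Me T thT.
pose E X : 'M[C]_d := vec_mx (mxvec X *m M).
(* The blocks of the mean of [E] and its conjugate by the adjoint.  This mean
   preserves hermiticity, and adding it to the identity still sends [S] into
   [S'], both spaces being closed under adjoints. *)
pose N a b := 2^-1 *: (E (delta_mx a b) + (E (delta_mx b a))^t*).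
have hN a b : (N a b)^t* = N b a.
  by rewrite /N adjZ adjD trmxCK addrC fmorphV rmorph_nat.
have Ee a b i j : `|E (delta_mx a b) i j| <= e.
  by rewrite mxE mxvec_delta -rowE mxE.
have Ne a b i j : `|N a b i j| <= e.
  rewrite !mxE normrM ger0_norm ?invr_ge0 // mulrC ler_pdivrMr //.
  apply: le_trans (ler_normD _ _) _; rewrite norm_conjC mulr_natr mulr2n.
  by apply: lerD; [have := Ee a b i j | have := Ee b a j i]; rewrite !mxE.
have [m [K [c [KE ce0 psdK]]]] := hermitian_choi_shift e0 hN Ne.
have Elin (X : 'M[C]_d) : \sum_a \sum_b X a b *: E (delta_mx a b) = E X.
  rewrite /E {2}(matrix_sum_delta X).
  rewrite linear_sum mulmx_suml linear_sum; apply: eq_bigr => a _ /=.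
  rewrite linear_sum mulmx_suml linear_sum; apply: eq_bigr => b _ /=.
  by rewrite linearZ -scalemxAl linearZ.
have NE (X : 'M[C]_d) : \sum_a \sum_b X a b *: N a b = 2^-1 *: (E X + (E (X^t*))^t*).
  rewrite -[in E X]Elin -[in E (X^t*)]Elin adj_sum.
  under [Z in _ + Z]eq_bigr do rewrite adj_sum.
  rewrite [Z in _ + Z]exchange_big -big_split scaler_sumr; apply: eq_bigr => a _ /=.
  rewrite -big_split scaler_sumr; apply: eq_bigr => b _ /=.
  by rewrite adjZ !mxE conjCK -scalerDr !scalerA mulrC.
have NS X : X \in S -> X + \sum_a \sum_b X a b *: N a b \in S'.
  move=> XS; rewrite NE.
  have -> : X + 2^-1 *: (E X + (E (X^t*))^t*) =
      2^-1 *: ((X + E X) + (X^t* + E (X^t*))^t*).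
    rewrite adjD trmxCK addrACA [RHS]scalerDr -mulr2n -(scaler_nat 2 X) scalerA.
    by rewrite mulVf ?pnatr_eq0 // scale1r.
  by rewrite memvZ // memvD ?S'adj // MS // Sadj.
set r := 1 + _; have r0 : 0 < r by rewrite ltr_pwDl.
case: (thT) => psdT _; split; first by apply: psdZ; rewrite ?invr_ge0 ?ltW.
move=> k Phi [[cpPhi tpPhi] graphPhi]; have [n [A hA]] := cp_kraus cpPhi.
have A1 := trace_preserving_kraus hA tpPhi.
have AS := graph_kraus hA graphPhi.
(* The output space is enlarged so that the products [B_p^* B_q] become the
   perturbed ones while [A_p] remains the top block of [B_p]. *)
pose B p : 'M[C]_(k + \sum_(l < m) k, d) := col_mx (A p) (\mxcol_(l < m) (A p *m (K l)^t*)).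
have BB p q : (B p)^t* *m B q = (A p)^t* *m A q + \sum_l K l *m ((A p)^t* *m A q) *m (K l)^t*.
  rewrite adj_col_mx mul_row_col adj_mxcol mul_mxrow_mxcol; congr (_ + _).
  by apply: eq_bigr => l _; rewrite adjM trmxCK !mulmxA.
have BS p q : (B p)^t* *m B q \in S'.
  by rewrite BB KE addrA memvD ?NS // -scalemx1 memvZ.
have psdB : psdmx (r%:M - \sum_p (B p)^t* *m B p).
  rewrite (eq_bigr _ (fun p _ => BB p p)) big_split /= A1 exchange_big /=.
  under eq_bigr do rewrite -mulmx_suml -mulmx_sumr A1 mulmx1.
  by rewrite opprD addrA /r raddfD /= [1%:M + _]addrC addrK.
have := th_subunital S'1 thT r0 BS psdB.
move=> /(psd_ul_block (B := fun p => A p *m T *m (A p)^t*)) psdA.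
rewrite /lemx linearZ hA.
have -> : 1%:M - r^-1 *: (\sum_p A p *m T *m (A p)^t*) =
    r^-1 *: (r%:M - \sum_p A p *m T *m (A p)^t*).
  by rewrite scalerBr scale_scalar_mx mulVf ?gt_eqF.
apply: psdZ; first by rewrite invr_ge0 ltW.
apply: psdA => p.
have EB : row_mx 1%:M 0 *m B p = A p.
  by rewrite mul_row_col mul0mx mul1mx addr0.
by rewrite !mulmxA EB -mulmxA -adjM EB.
Qed.

End NearGraph.

(** * Convergence of complex matrices and orthogonal projections *)

Section MatrixTopology.
Context {K : numFieldType}.

Lemma mx_cvg {T : Type} (F : set_system T) {FF : Filter F} m n
    (f : T -> 'M[K]_(m, n)) (L : 'M[K]_(m, n)) :
  (forall i j, f x i j @[x --> F] --> L i j) -> f x @[x --> F] --> L.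
Proof.
move=> fL A [P LP sub].
have : \forall x \near F, forall i j, P i j (f x i j).
  by apply: filter_forall => i; apply: filter_forall => j; apply: fL (LP i j).
by apply: filterS => x Px; exact: sub.
Qed.

Lemma cvg_entry {T : Type} (F : set_system T) {FF : Filter F} m n
    (f : T -> 'M[K]_(m, n)) (L : 'M[K]_(m, n)) i j :
  f x @[x --> F] --> L -> f x i j @[x --> F] --> L i j.
Proof. by move=> fL; apply: cvg_comp fL (@coord_continuous K m n i j L). Qed.

Lemma cvg_sum {T : Type} (F : set_system T) {FF : Filter F} (I : Type)
    (r : seq I) (f : I -> T -> K) (L : I -> K) :
  (forall i, f i x @[x --> F] --> L i) ->
  \sum_(i <- r) f i x @[x --> F] --> \sum_(i <- r) L i.
Proof.
move=> fL; elim: r => [|i r IH].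
  rewrite big_nil; under eq_fun do rewrite big_nil; exact: cvg_cst.
rewrite big_cons; under eq_fun do rewrite big_cons.
by apply: cvgD => //; exact: fL.
Qed.

Lemma cvg_mulmx {T : Type} (F : set_system T) {FF : Filter F} m n p
    (f : T -> 'M[K]_(m, n)) (g : T -> 'M[K]_(n, p))
    (A : 'M[K]_(m, n)) (B : 'M[K]_(n, p)) :
  f x @[x --> F] --> A -> g x @[x --> F] --> B ->
  f x *m g x @[x --> F] --> A *m B.
Proof.
move=> fA gB; apply: mx_cvg => i j.
rewrite mxE; under eq_fun do rewrite mxE; apply: cvg_sum => k.
by apply: cvgM; exact: cvg_entry.
Qed.

(** A cluster point of a sequence is a limit along some filter finer than the
    one at infinity, hence limits along it may be combined with limits of
    convergent sequences. *)
Lemma cluster_seq (T : topologicalType) (u : nat -> T) (x : T) :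
  cluster (u @ \oo) x ->
  exists2 G : set_system nat, ProperFilter G & \oo `<=` G /\ u @ G --> x.
Proof.
move=> ux; exists (filter_from [set AB : set nat * set T | \oo AB.1 /\ nbhs x AB.2]
  (fun AB => AB.1 `&` u @^-1` AB.2)).
  apply: filter_from_proper => [|[A B] /= [ooA xB]]; last first.
    have [_ [[n An <-] Bn]] := ux (u @` A) B (filterS (fun n An => ex_intro2 _ _ n An erefl) ooA) xB.
    by exists n.
  apply: filter_from_filter; first by exists (setT, setT); split; exact: filterT.
  move=> [A B] [A' B'] /= [? ?] [? ?]; exists (A `&` A', B `&` B').
    by split; exact: filterI.
  by move=> n [[? ?] [? ?]].
split=> [A ooA|B xB].
  by exists (A, setT) => [|n []//]; split=> //; exact: filterT.
by exists (setT, B) => [|n []//]; split=> //; exact: filterT.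
Qed.

Lemma mx_hausdorff m n : hausdorff_space 'M[K]_(m, n).
Proof. exact: norm_hausdorff. Qed.

Lemma mx_compact m n (V : set K) :
  compact V -> compact [set M : 'M[K]_(m, n) | forall i j, V (M i j)].
Proof.
move=> cV.
have cr := @rV_compact K (m * n) (fun=> V) (fun=> cV).
have vec_cts : continuous (vec_mx : 'rV[K]_(m * n) -> 'M[K]_(m, n)).
  move=> v; apply: (mx_cvg (FF := nbhs_filter v)) => i j; rewrite mxE; under eq_fun do rewrite mxE.
  exact: coord_continuous.
have := continuous_compact (continuous_subspaceT vec_cts) cr.
congr compact; apply/seteqP; split=> [_ [v vV <-] i j|M MV].
  by rewrite mxE; exact: vV.
exists (mxvec M); last exact: mxvecK.
by case/mxvec_indexP => i j; rewrite mxvecE; exact: MV.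
Qed.

End MatrixTopology.

Section ComplexTopology.
Context {R : realType}.
Local Notation C := (Cx R).

(** The real embedding, retyped so that its codomain carries the norm
    topology. *)
Definition embC (r : R) : C := r%:C%C.

Lemma embC_continuous : continuous embC.
Proof.
move=> r; apply/cvgrPdist_lt => e e0.
have [e' eE] : exists e', e = embC e' by apply/complex_realP; exact: gtr0_real.
have e'0 : 0 < e' by move: e0; rewrite eE -ltcR.
near=> s.
rewrite eE /embC -rmorphB /= -[`|_|]/(`|(r - s)%:C%C : R[i]|) normc_def /=.
rewrite expr0n addr0 sqrtr_sqr ltcR.
near: s; apply: cvgr_dist_lt => //; exact: cvg_id.
Unshelve. all: by end_near.
Qed.

Lemma Re_continuous : continuous (fun z : C => complex.Re z).
Proof.
move=> z; have FF := @nbhs_filter C z.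
apply/(@cvgrPdist_lt _ _ C _ FF) => e e0.
have e'0 : 0 < embC e by move: e0; rewrite -ltcR.
have : \forall w \near nbhs z, `|z - w| < embC e.
  by apply: cvgr_dist_lt => //; exact: cvg_id.
apply: filterS => w; rewrite -raddfB /= -ltcR.
by apply: le_lt_trans; exact: normc_ge_Re.
Qed.

(** The square of side [4] about the origin; it is a neighbourhood of every
    point of the closed unit disc, as [compact_cluster_set1] asks. *)
Lemma compact_nbhs_disc :
  exists2 V : set C, compact V & forall z : C, `|z| <= 1 -> nbhs z V.
Proof.
pose f (ab : R * R) : C := embC ab.1 + 'i%C * embC ab.2.
have f_cts : continuous f.
  move=> ab; apply: cvgD.
    by apply: continuous_comp; [exact: cvg_fst | exact: embC_continuous].
  apply: cvgM; first exact: cvg_cst.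
  by apply: continuous_comp; [exact: cvg_snd | exact: embC_continuous].
pose I : set R := `[-2, 2]%classic.
exists (f @` (I `*` I)).
  apply: continuous_compact; first exact: continuous_subspaceT.
  by apply: compact_setX; exact: segment_compact.
move=> z z1; have : \forall w \near nbhs z, `|z - w| < 1.
  by apply: cvgr_dist_lt => //; exact: cvg_id.
apply: filterS => w zw; have w2 : `|w| <= embC 2.
  have -> : w = z - (z - w) by rewrite opprB addrC subrK.
  apply: le_trans (ler_normB _ _) _.
  by rewrite /embC [2%:R]mulr2n rmorphD /= lerD // ltW.
exists (complex.Re w, complex.Im w); last by rewrite /f /embC -complexE.
split; rewrite /I /= in_itv /= -ler_norml -lecR;
  apply: le_trans w2; [exact: normc_ge_Re|].
have := normc_ge_Re (w * 'i%C); rewrite ReiNIm normrN normrM.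
by rewrite [`|'i%C|]normc_def /= expr0n expr1n add0r sqrtr1 mulr1.
Qed.

Lemma cvg_conj {T : Type} (F : set_system T) {FF : Filter F} (f : T -> C) (z : C) :
  f x @[x --> F] --> z -> (f x)^* @[x --> F] --> z^*.
Proof.
move=> fz; apply/cvgrPdist_lt => e e0.
have : \forall x \near F, `|z - f x| < e by exact: cvgr_dist_lt.
by apply: filterS => x; rewrite -rmorphB norm_conjC.
Qed.

Lemma cvg_adj {T : Type} (F : set_system T) {FF : Filter F} m n
    (f : T -> 'M[C]_(m, n)) (L : 'M[C]_(m, n)) :
  f x @[x --> F] --> L -> (f x)^t* @[x --> F] --> L^t*.
Proof.
move=> fL; apply: mx_cvg => i j; rewrite !mxE; under eq_fun do rewrite !mxE.
by apply: cvg_conj; exact: cvg_entry.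
Qed.

Lemma cvg_ge0 {T : Type} (F : set_system T) {FF : ProperFilter F} (f : T -> C) (z : C) :
  f x @[x --> F] --> z -> (forall x, 0 <= f x) -> 0 <= z.
Proof.
move=> fz f0; have -> : z = `|z|; last exact: normr_ge0.
apply: (cvg_unique (@norm_hausdorff C C) fz).
have -> : f = fun x => `|f x| by apply/funext => x; rewrite ger0_norm.
exact: cvg_norm.
Qed.

Lemma cvg_psdmx {T : Type} (F : set_system T) {FF : ProperFilter F} n
    (f : T -> 'M[C]_n) (L : 'M[C]_n) :
  f x @[x --> F] --> L -> (forall x, psdmx (f x)) -> psdmx L.
Proof.
move=> fL psdf; apply/psdmxP; split.
  apply: (cvg_unique (@mx_hausdorff C n n) _ fL).
  have -> : f = fun x => (f x)^t* by apply/funext => x; rewrite psd_adj.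
  exact: cvg_adj.
move=> v.
apply: (@cvg_ge0 _ F _ (fun x => (v^t* *m f x *m v) 0 0)).
  apply: cvg_entry; apply: cvg_mulmx; last exact: cvg_cst.
  by apply: cvg_mulmx => //; exact: cvg_cst.
by move=> x; case/psdmxP: (psdf x).
Qed.

End ComplexTopology.

Section Projection.
Context {R : realType}.
Local Notation C := (Cx R).

(** Orthogonality, as opposed to the choice of just any complement, is what
    keeps the projections onto varying spaces bounded. *)
Lemma orthogonal_projection d (S : {vspace 'M[C]_d}) :
  exists P : 'M[C]_(d * d), [/\ P^t* = P, P *m P = P &
    forall X, X \in S <-> mxvec X *m P = mxvec X].
Proof.
pose U := \matrix_(i < \dim S) mxvec (vbasis S)`_i.
have US X : X \in S <-> (mxvec X <= U)%MS.
  split=> [XS|/submxP[D eX]].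
    rewrite (coord_vbasis XS) linear_sum summx_sub // => i _.
    by rewrite linearZ scalemx_sub // (submx_trans _ (row_sub i U)) // rowK.
  have -> : X = \sum_i D 0 i *: (vbasis S)`_i.
    apply: (can_inj mxvecK); rewrite eX mulmx_sum_row linear_sum.
    by apply: eq_bigr => i _; rewrite rowK linearZ.
  by apply: memv_suml => i _; rewrite memvZ // vbasis_mem // mem_nth // size_tuple.
exists (proj_ortho U); set P := proj_ortho U.
have PP : P *m P = P by exact: proj_ortho_proj.
have eP : P^t* = P *m P^t*.
  have /submxP[D eD] : (P <= U)%MS by rewrite proj_orthoE.
  have := proj_ortho_compl_sub U 1%:M; rewrite mul1mx -/P => /orthomx1P UP.
  apply/eqP; rewrite -subr_eq0 -{1}(mul1mx (P^t*)) -mulmxBl {2}eD adjM mulmxA UP.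
  by rewrite mul0mx.
split=> // [|X].
  move: (P) eP => Q eQ; have := congr1 (fun Z : 'M[C]_(d * d) => Z^t*) eQ.
  by rewrite adjM trmxCK => {2}->.
rewrite US; split=> [XU|<-]; first exact: proj_ortho_id.
exact: proj_ortho_sub.
Qed.

(** [P = P^* P] makes a diagonal entry the squared norm of its column. *)
Lemma projection_entry_le1 n (P : 'M[C]_n) : P^t* = P -> P *m P = P ->
  forall i j, `|P i j| <= 1.
Proof.
move=> hP PP i j.
have PE k : P k k = \sum_l `|P l k| ^+ 2 by rewrite -gram_entryE hP PP.
have P0 k : 0 <= P k k by rewrite PE sumr_ge0 // => l _; rewrite exprn_ge0.
have Pk l k : `|P l k| ^+ 2 <= P k k.
  by rewrite PE (bigD1 l) //= lerDl sumr_ge0 // => ? _; rewrite exprn_ge0.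
have P1 k : P k k <= 1.
  have := Pk k k; rewrite ger0_norm // expr2.
  have [->|nz] := eqVneq (P k k) 0; first by rewrite ler01.
  by rewrite ger_pMr // lt_def nz P0.
by rewrite -(@expr_le1 _ 2) // (le_trans (Pk _ _)).
Qed.

End Projection.

(** * Continuity of th and theta *)

Section Continuity.
Context {R : realType}.
Local Notation C := (Cx R).

(** By compactness it suffices that [P] is the only cluster point.  For a
    cluster point [Q], the inclusion of [S] in the lower limit gives [P Q = P],
    that of the upper limit in [S] gives [Q P = Q], and taking adjoints
    identifies the two. *)
Lemma projection_cvg d (S : {vspace 'M[C]_d}) (Sn : nat -> {vspace 'M[C]_d})
    (P : 'M[C]_(d * d)) (Pn : nat -> 'M[C]_(d * d)) :
  P^t* = P -> P *m P = P -> (forall X, X \in S <-> mxvec X *m P = mxvec X) ->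
  (forall n, (Pn n)^t* = Pn n) -> (forall n, Pn n *m Pn n = Pn n) ->
  (forall n X, X \in Sn n <-> mxvec X *m Pn n = mxvec X) ->
  kuratowski_cvg (fun n => [set` Sn n]) [set` S] ->
  Pn n @[n --> \oo] --> P.
Proof.
move=> hP PP SP hPn PPn SPn [limS supS].
have [V cV nV] := @compact_nbhs_disc R.
have cVmx := @mx_compact C (d * d) (d * d) V cV.
have clus Q : cluster (Pn @ \oo) Q -> Q = P.
  case/cluster_seq => G PG [ooG PnQ].
  have hQ : Q^t* = Q.
    apply: (cvg_unique (@mx_hausdorff C _ _) _ PnQ).
    have -> : Pn = fun n => (Pn n)^t* by apply/funext => n; rewrite hPn.
    exact: cvg_adj.
  have PQ : P *m Q = P.
    apply/row_matrixP => s; rewrite row_mul -[row s P]vec_mxK.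
    have : vec_mx (row s P) \in [set` S].
      by rewrite inE /=; apply/SP; rewrite vec_mxK -row_mul PP.
    rewrite limS inE => -[u [uS ulim]].
    have ulimG : mxvec (u n) @[n --> G] --> mxvec (vec_mx (row s P)).
      apply: mx_cvg => i; case/mxvec_indexP => a b; rewrite ord1 mxvecE.
      under eq_fun do rewrite mxvecE.
      by apply: cvg_entry => A /ulim; exact: ooG.
    apply: (cvg_unique (@mx_hausdorff C _ _) _ ulimG).
    have -> : (fun n => mxvec (u n)) = fun n => mxvec (u n) *m Pn n.
      by apply/funext => n; apply/esym/SPn; exact: uS.
    exact: cvg_mulmx.
  have QP : Q *m P = Q.
    apply/row_matrixP => s; rewrite row_mul -[row s Q]vec_mxK; apply/SP.
    suff : [set` S] (vec_mx (row s Q)) by [].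
    rewrite supS; exists (fun n => vec_mx (row s (Pn n))); split=> [n|A B oA nB].
      by apply/SPn; rewrite vec_mxK -row_mul PPn.
    have vlim : vec_mx (row s (Pn n)) @[n --> G] --> (vec_mx (row s Q) : 'M[C]_d).
      apply: mx_cvg => i j; rewrite !mxE; under eq_fun do rewrite !mxE.
      exact: cvg_entry.
    have GA := ooG _ oA.
    have GB : G ((fun n => vec_mx (row s (Pn n))) @^-1` B) by exact: vlim.
    by have [n [An Bn]] := filter_ex (filterI GA GB); exists (vec_mx (row s (Pn n))).
  have := congr1 (fun Z : 'M[C]_(d * d) => Z^t*) PQ.
  by rewrite adjM hQ hP QP.
have PnV : \forall n \near \oo, [set M : 'M[C]_(d * d) | forall i j, V (M i j)] (Pn n).
  apply: nearW => n i j; apply: nbhs_singleton.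
  by apply: nV; exact: projection_entry_le1.
apply: (compact_cluster_set1 (@mx_hausdorff C _ _) cVmx) => //.
  exists (fun i j => V) => // i j.
  by apply: nV; exact: projection_entry_le1.
apply/seteqP; split=> [Q /clus //|_ ->].
have [Q [_ cQ]] := cVmx (Pn @ \oo) (fmap_proper_filter Pn _) PnV.
by rewrite -(clus _ cQ).
Qed.

(** The identity is a channel of every operator system, so [T <= I]. *)
Lemma th_bound d (S : {vspace 'M[C]_d}) T :
  operator_system S -> th S T -> complex.Re (\tr T) <= d%:R.
Proof.
move=> [S1 _] thT.
have AS (p q : 'I_1) : (1%:M : 'M[C]_d)^t* *m 1%:M \in S.
  by rewrite adj_scalar conjC1 mulmx1.
have := th_subunital S1 thT ltr01 AS.
rewrite !big_ord1 adj_scalar conjC1 !mulmx1 mul1mx subrr => /(_ (psd0 _)).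
case/psd_factor => G eG.
have : 0 <= \tr (1%:M - T) by rewrite eG sumr_ge0 // => i _; exact: gram_entry_ge0.
rewrite raddfB /= mxtrace1 subr_ge0 => Td; have : (\tr T : R[i]) <= (d%:R : R[i]) := Td.
by rewrite lecE => /andP[_]; rewrite (raddfMn (@complex.Re R)).
Qed.

Lemma theta_le d (S S' : {vspace 'M[C]_d}) (r : C) :
  operator_system S' -> 0 < r ->
  (forall T, th S T -> th S' (r^-1 *: T)) -> (complex.Re r)^-1 * theta S <= theta S'.
Proof.
move=> hS' r0 SS'.
have [rho eR] : exists rho, r = embC rho by apply/complex_realP; exact: gtr0_real.
have rho0 : 0 < rho by move: r0; rewrite eR -ltcR.
rewrite eR /= ler_pdivrMl //; apply: ge_sup => [|_ [T thT <-]].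
  exists 0, 0; last by rewrite mxtrace0.
  split=> [|k Phi _]; first exact: psd0.
  by rewrite linear0 /lemx subr0; exact: psd1.
rewrite -ler_pdivrMl //; apply: ub_le_sup.
  by exists d%:R => _ [T' thT' <-]; exact: th_bound hS' thT'.
exists (r^-1 *: T); first exact: SS'.
rewrite mxtraceZ eR -fmorphV; case: (\tr T) => a b /=.
by rewrite mul0r subr0.
Qed.

Lemma sum_entries_ge n (M : 'M[C]_n) s t :
  `|M s t| <= \sum_i \sum_j `|M i j|.
Proof.
rewrite (bigD1 s) //= (bigD1 t) //= -addrA lerDl addr_ge0 //.
  exact: sumr_ge0.
by apply: sumr_ge0 => i _; exact: sumr_ge0.
Qed.

(** One factor serves both directions: the error is the total size of
    [P (P_n - 1)] and [P_n (P - 1)]. *)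
Lemma th_scaling d (S : {vspace 'M[C]_d}) (Sn : nat -> {vspace 'M[C]_d}) :
  operator_system S -> (forall n, operator_system (Sn n)) ->
  kuratowski_cvg (fun n => [set` Sn n]) [set` S] ->
  exists r : nat -> C, [/\ forall n, 0 < r n, r n @[n --> \oo] --> (1 : C),
    forall n T, th S T -> th (Sn n) ((r n)^-1 *: T) &
    forall n T, th (Sn n) T -> th S ((r n)^-1 *: T)].
Proof.
move=> hS hSn lim.
have [P [hP PP SP]] := orthogonal_projection S.
have /choice[Pn hPn] := fun n => orthogonal_projection (Sn n).
have PnP : Pn n @[n --> \oo] --> P.
  by apply: (projection_cvg hP PP SP _ _ _ lim) => n; case: (hPn n).
pose M n := P *m (Pn n - 1%:M); pose M' n := Pn n *m (P - 1%:M).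
pose sz (Z : 'M[C]_(d * d)) : C := \sum_i \sum_j `|Z i j|.
have sz0 Z : 0 <= sz Z by apply: sumr_ge0 => i _; exact: sumr_ge0.
have sz_cvg (f : nat -> 'M[C]_(d * d)) : f n @[n --> \oo] --> (0 : 'M[C]_(d * d)) ->
    sz (f n) @[n --> \oo] --> (0 : C).
  move=> f0; have -> : (0 : C) = sz 0.
    by rewrite /sz big1 // => i _; rewrite big1 // => j _; rewrite mxE normr0.
  apply: cvg_sum => i; apply: cvg_sum => j; apply: cvg_norm; exact: cvg_entry.
pose e n := sz (M n) + sz (M' n).
have e0 n : 0 <= e n by rewrite addr_ge0.
have e_cvg : e n @[n --> \oo] --> (0 : C).
  rewrite -(addr0 (0 : C)); apply: cvgD; apply: sz_cvg.
    have -> : (0 : 'M[C]_(d * d)) = P *m (P - 1%:M) by rewrite mulmxBr PP mulmx1 subrr.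
    apply: cvg_mulmx; first exact: cvg_cst.
    by apply: cvgB; [exact: PnP | exact: cvg_cst].
  have -> : (0 : 'M[C]_(d * d)) = P *m (P - 1%:M) by rewrite mulmxBr PP mulmx1 subrr.
  by apply: cvg_mulmx; [exact: PnP | exact: cvg_cst].
exists (fun n => 1 + (d ^ 3 + d ^ 2)%:R * e n); split.
- by move=> n; rewrite ltr_pwDl // mulr_ge0.
- rewrite -[X in _ --> X]addr0 -(mulr0 ((d ^ 3 + d ^ 2)%:R : C)).
  by apply: cvgD; [exact: cvg_cst | apply: cvgM; [exact: cvg_cst | exact: e_cvg]].
- move=> n; have [hPn' PPn SPn] := hPn n.
  apply: (@th_of_near_graph _ _ (Sn n) S (M' n)) => //.
    move=> X /SPn XS; rewrite /M' mulmxA XS mulmxBr mulmx1 linearB /= mxvecK addrC subrK.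
    by apply/SP; rewrite vec_mxK -mulmxA PP.
  by move=> s t; apply: le_trans (sum_entries_ge _ _ _) _; rewrite /e lerDr.
move=> n; have [hPn' PPn SPn] := hPn n.
apply: (@th_of_near_graph _ _ S (Sn n) (M n)) => //.
  move=> X /SP XS; rewrite /M mulmxA XS mulmxBr mulmx1 linearB /= mxvecK addrC subrK.
  by apply/SPn; rewrite vec_mxK -mulmxA PPn.
by move=> s t; apply: le_trans (sum_entries_ge _ _ _) _; rewrite /e lerDl.
Qed.

(** Each channel is continuous, being given by finitely many Kraus
    operators. *)
Lemma th_closed {I : Type} (F : set_system I) {FF : ProperFilter F} d
    (S : {vspace 'M[C]_d}) (f : I -> 'M[C]_d) (T : 'M[C]_d) :
  f n @[n --> F] --> T -> (forall n, th S (f n)) -> th S T.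
Proof.
move=> fT thf; split.
  by apply: (cvg_psdmx fT) => n; case: (thf n).
move=> k Phi chPhi.
apply: (@cvg_psdmx _ _ F _ _ (fun n => 1%:M - Phi (f n))) => [|n].
  apply: cvgB; first exact: cvg_cst.
  have [m [A hA]] := cp_kraus chPhi.1.1.
  rewrite hA; under eq_fun do rewrite hA.
  apply: mx_cvg => i j; rewrite summxE; under eq_fun do rewrite summxE.
  apply: cvg_sum => p; apply: cvg_entry; apply: cvg_mulmx; last exact: cvg_cst.
  by apply: cvg_mulmx; [exact: cvg_cst | exact: fT].
by case: (thf n) => _ /(_ _ _ chPhi).
Qed.

Lemma cvg_scale {I : Type} (F : set_system I) {FF : ProperFilter F} m n
    (r : I -> C) (f : I -> 'M[C]_(m, n)) (T : 'M[C]_(m, n)) :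
  r x @[x --> F] --> (1 : C) -> f x @[x --> F] --> T ->
  (r x)^-1 *: f x @[x --> F] --> T.
Proof.
move=> r1 fT; apply: mx_cvg => i j; under eq_fun do rewrite mxE.
rewrite -[T i j]mul1r -[X in X * _]invr1; apply: cvgM; last exact: cvg_entry.
by apply: cvgV r1; exact: oner_neq0.
Qed.

End Continuity.

Theorem theorem6p11 (R : realType) (d : nat)
  (S : {vspace 'M[Cx R]_d}) (Sn : nat -> {vspace 'M[Cx R]_d})
  (hS : operator_system S) (hSn : forall n, operator_system (Sn n))
  (hlim : kuratowski_cvg (fun n => [set` Sn n]) [set` S]) :
  kuratowski_cvg (fun n => th (Sn n)) (th S) /\
  theta (Sn n) @[n --> \oo] --> theta S.
Proof.
have [r [r0 r1 toSn toS]] := th_scaling hS hSn hlim.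
have inf : th S `<=` kuratowski_liminf (fun n => th (Sn n)).
  move=> T thT; exists (fun n => (r n)^-1 *: T); split=> [n|]; first exact: toSn.
  by apply: cvg_scale r1 _; exact: cvg_cst.
have infsup : kuratowski_liminf (fun n => th (Sn n)) `<=`
    kuratowski_limsup (fun n => th (Sn n)).
  move=> T [u [thu uT]]; exists u; split=> // A B uA nB.
  have uB : (u @ \oo) B by exact: uT.
  exact: (@filter_ex _ (u @ \oo) (fmap_proper_filter u _) _ (filterI uA uB)).
have sup : kuratowski_limsup (fun n => th (Sn n)) `<=` th S.
  move=> T [u [thu /cluster_seq[G PG [ooG uT]]]].
  apply: (th_closed (F := G) (f := fun n => (r n)^-1 *: u n)).
    by apply: cvg_scale uT => A /r1; exact: ooG.
  by move=> n; exact: toS.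
split.
  by split; apply/seteqP; split=> // T; [move/infsup/sup | move/inf/infsup].
have rho1 : complex.Re (r n) @[n --> \oo] --> (1 : R).
  exact: (cvg_comp _ _ r1 (@Re_continuous R (1 : Cx R))).
have rho0 n : 0 < complex.Re (r n).
  by have : (0 : R[i]) < (r n : R[i]) := r0 n; rewrite ltcE => /andP[].
apply: (@squeeze_cvgr _ _ _ _ (fun n => (complex.Re (r n))^-1 * theta S)
                              (fun n => complex.Re (r n) * theta S)).
- apply: nearW => n; apply/andP; split; first exact: theta_le (toSn n).
  by rewrite -ler_pdivrMl //; exact: theta_le (toS n).
- rewrite -[X in _ --> X]mul1r -[X in X * _]invr1.
  by apply: cvgM; [apply: cvgV rho1; exact: oner_neq0 | exact: cvg_cst].
- by rewrite -[X in _ --> X]mul1r; apply: cvgM; [exact: rho1 | exact: cvg_cst].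
Qed.
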